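(* Let $q$ be a prime power, $n\ge1$, and let $M$ be chosen uniformly at random from $\mathrm{SL}(n,\mathbb{F}_q)$. Then for every integer $0\le h<n$ and every monic $f\in\mathbb{F}_q[T]$ of degree $n$, $$\left|\mathbb{P}_{M\in\mathrm{SL}(n,\mathbb{F}_q)}\big(\det(T-M)\in I(f;h)\big)-\frac{q^{h+1}}{q^n}\right|\le\frac{(q-1)(n-h)}{q^n}.$$
   Context: $\mathrm{SL}(n,\mathbb{F}_q)$ is the group of $n\times n$ matrices over $\mathbb{F}_q$ of determinant $1$, with uniform probability measure. For a monic $f$ of degree $n$ and $0\le h\le n-1$, $I(f;h)=\{g\in\mathbb{F}_q[T]\text{ monic}:\deg(f-g)\le h\}$ (with $\deg0=-\infty$). *)

(* Defs.v *)
From HB Require Import structures.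
From mathcomp Require Import all_boot all_order all_algebra.
Set Implicit Arguments. Unset Strict Implicit. Unset Printing Implicit Defensive.
Import Order.TTheory GRing.Theory Num.Theory.
Local Open Scope ring_scope.

Definition SL_set (F : finFieldType) (n : nat) : {set 'M[F]_n} :=
  [set M : 'M[F]_n | \det M == 1].

Definition prob_SL (F : finFieldType) (n : nat) (P : pred 'M[F]_n) : rat :=
  (#|[set M in SL_set F n | P M]|)%:R / (#|SL_set F n|)%:R.

Definition in_I (F : fieldType) (f : {poly F}) (h : nat) (g : {poly F}) : bool :=
  (g \is monic) && (size (f - g)%R <= h.+1)%N.

(* Main.v *)
(**
Count pairs (M, v) of an n x n matrix and a row vector according to the
dimension m of the cyclic subspace spanned by v, v M, v M^2, ...  Completing
v, ..., v M^(m-1) to a basis puts M in block triangular form with a companion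
matrix of a monic e of degree m and an arbitrary D of size k = n - m on the
diagonal; double counting the completions gives, for every predicate Q,

  q^n #{M | Q (char_poly M)} / |GL_n|
    = sum over m + k = n of
      #{(e, D) | e monic of degree m, Q (e * char_poly D)} / |GL_k|.

Take Q g := "g lies in I(f; h) and g(0) = (-1)^n".  A singular D contributes
nothing.  If k <= h, each invertible D admits exactly q^(h-k) choices of e; if
k > h, at most one, since (e - e') * char_poly D has degree <= h < k for two
choices e, e'.  So the right-hand side is 1 + q + ... + q^h + t with
0 <= t <= n - h, and |GL_n| = (q - 1) |SL_n| gives
P - q^(h+1) / q^n = ((q - 1) t - 1) / q^n.
*)
Require Import Defs.
From HB Require Import structures.
From mathcomp Require Import all_boot all_order all_algebra.
From mathcomp Require Import zify ring lra.
Import Order.TTheory GRing.Theory Num.Theory.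
Local Open Scope ring_scope.

Set Implicit Arguments. Unset Strict Implicit. Unset Printing Implicit Defensive.

(** * Krylov matrices of a pair formed by a matrix and a row vector *)

Definition krylov {F : fieldType} {n : nat} (m : nat) (x : 'M[F]_n * 'rV[F]_n) :
  'M[F]_(m, n) := \matrix_(i < m) (x.2 *m x.1 ^+ i).

(** Appending one row raises the rank by at most one, and by exactly one when the new row lies
    outside the old row space. *)
Lemma row_free_krylovS (F : fieldType) (n m : nat) (x : 'M[F]_n * 'rV[F]_n) :
  row_free (krylov m.+1 x) =
  row_free (krylov m x) && ~~ (x.2 *m x.1 ^+ m <= krylov m x)%MS.
Proof.
set u := x.2 *m _.
have eqK : \rank (krylov m.+1 x) = \rank (krylov m x + u)%MS.
  apply/eqP; rewrite eqn_leq; apply/andP; split; apply: mxrankS.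
    apply/row_subP => i; rewrite rowK.
    case: (ltngtP i m) => [lt_im|lt_mi|->]; last by rewrite addsmxSr.
      apply: submx_trans (addsmxSl _ _).
      by have := row_sub (Ordinal lt_im) (krylov m x); rewrite rowK.
    by move: (ltn_ord i); rewrite ltnS leqNgt lt_mi.
  rewrite addsmx_sub; apply/andP; split.
    apply/row_subP => i; rewrite rowK.
    by have := row_sub (widen_ord (leqnSn m) i) (krylov m.+1 x); rewrite rowK.
  by have := row_sub ord_max (krylov m.+1 x); rewrite rowK.
rewrite /row_free eqK; case: (boolP (u <= _)%MS) => [uK|uK].
  rewrite andbF (addsmx_idPl uK) ltn_eqF //.
  by rewrite ltnS rank_leq_row.
have ltK : (\rank (krylov m x) < \rank (krylov m x + u)%MS)%N.
  apply: rank_ltmx; rewrite ltmxE addsmxSl /=.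
  by apply: contra uK; apply: submx_trans; rewrite addsmxSr.
have leK : (\rank (krylov m x + u)%MS <= (\rank (krylov m x)).+1)%N.
  apply: leq_trans (mxrank_adds_leqif _ _) _.
  rewrite -[leqRHS]addn1 leq_add2l.
  exact: rank_leq_row.
have -> : \rank (krylov m x + u)%MS = (\rank (krylov m x)).+1.
  by apply/eqP; rewrite eqn_leq leK.
by rewrite eqSS andbT.
Qed.

(** * Counting tools and completion of independent rows to an invertible matrix *)

Lemma double_count (S T : finType) (A : pred S) (B : pred T) (R : S -> T -> bool) :
  (\sum_(x | A x) #|[set y | B y && R x y]| =
   \sum_(y | B y) #|[set x | A x && R x y]|)%N.
Proof.
under eq_bigr => x _ do rewrite -sum1dep_card.
rewrite (exchange_big_dep B) /=; last by move=> x y _ /andP[].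
apply: eq_bigr => y By; rewrite -sum1dep_card.
by apply: eq_bigl => x; rewrite By.
Qed.

Lemma char_poly_conj_unit (F : fieldType) (n : nat) (P M : 'M[F]_n) :
  P \in unitmx -> char_poly (P *m M *m invmx P) = char_poly M.
Proof.
move=> uP; rewrite /char_poly /char_poly_mx.
have uPp : map_mx polyC P *m map_mx polyC (invmx P) = 1%:M.
  by rewrite -map_mxM mulmxV // map_mx1.
have -> : 'X%:M - map_mx polyC (P *m M *m invmx P) =
    map_mx polyC P *m ('X%:M - map_mx polyC M) *m map_mx polyC (invmx P).
  rewrite mulmxBr mulmxBl !map_mxM; congr (_ - _).
  by rewrite scalar_mxC -mulmxA uPp mulmx1.
by rewrite !det_mulmx mulrAC -det_mulmx uPp det1 mul1r.
Qed.

Definition unit_count (F : finFieldType) (k : nat) : nat :=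
  #|[set P : 'M[F]_k | P \in unitmx]|.

Lemma unitmx_lblock1 (F : fieldType) (m k : nat) (B : 'M[F]_(k, m)) (D : 'M[F]_k) :
  (block_mx 1%:M 0 B D \in unitmx) = (D \in unitmx).
Proof. by rewrite !unitmxE det_lblock det1 mul1r. Qed.

(** Such a matrix is block lower triangular with identity corner: its lower left block is free, and
    its lower right block must be invertible. *)
Lemma card_unit_usubmx_id (F : finFieldType) (m k : nat) :
  #|[set P : 'M[F]_(m + k) | (P \in unitmx) && (usubmx P == row_mx 1%:M 0)]|
  = (#|F| ^ (k * m) * unit_count F k)%N.
Proof.
pose f (BD : 'M[F]_(k, m) * 'M[F]_k) := block_mx (1%:M : 'M[F]_m) 0 BD.1 BD.2.
have f_inj : injective f by move=> [B D] [B' D'] /eq_block_mx[_ _ /= -> ->].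
rewrite /unit_count -card_mx -cardsT -cardsX -(card_imset _ f_inj).
apply: eq_card => P; rewrite inE; apply/andP/imsetP => [[uP /eqP idP1]|].
  have idP2 : P = f (dlsubmx P, drsubmx P).
    by rewrite -[LHS]vsubmxK idP1 -[dsubmx P]hsubmxK.
  exists (dlsubmx P, drsubmx P) => //.
  by rewrite !inE /= -(unitmx_lblock1 (dlsubmx P)) -[block_mx _ _ _ _]idP2.
case=> [[B D]]; rewrite !inE /= => uD ->.
by rewrite /f /= unitmx_lblock1 uD /block_mx col_mxKu.
Qed.

(** In the rank factorisation [col_ebase A *m pid_mx m *m row_ebase A], the first two factors have
    product [row_mx (col_ebase A) 0], which an identity block completes to an invertible matrix. *)
Lemma row_free_extend (F : fieldType) (m k : nat) (A : 'M[F]_(m, m + k)) :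
  row_free A -> exists2 U : 'M[F]_(m + k), U \in unitmx & usubmx U = A.
Proof.
move=> /eqP rA; pose U := block_mx (col_ebase A) 0 0 (1%:M : 'M[F]_k) *m row_ebase A.
exists U.
  rewrite unitmx_mul row_ebase_unit andbT block_diag_mx_unit col_ebase_unit.
  exact: unitmx1.
rewrite /U /block_mx mul_col_mx col_mxKu -[RHS]mulmx_ebase rA pid_mx_row.
by rewrite mul_mx_row mulmx1 mulmx0.
Qed.

(** Right multiplication by the inverse of one completion [U] of [A] reduces to top rows
    [row_mx 1%:M 0]; the count therefore does not depend on [A]. *)
Lemma card_unit_usubmx (F : finFieldType) (m k : nat) (A : 'M[F]_(m, m + k)) :
  row_free A ->
  #|[set P : 'M[F]_(m + k) | (P \in unitmx) && (usubmx P == A)]|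
  = (#|F| ^ (k * m) * unit_count F k)%N.
Proof.
move=> /row_free_extend[U uU defA].
have fI : injective (mulmx^~ (invmx U) : 'M[F]_(m + k) -> 'M[F]_(m + k)).
  by move=> P P' /(congr1 (mulmx^~ U)); rewrite !mulmxKV.
rewrite -card_unit_usubmx_id -[RHS](card_preimset _ fI).
apply: eq_card => P; rewrite !inE unitmx_mul unitmx_inv uU andbT; congr (_ && _).
have uK (X : 'M[F]_(m + k)) (Y : 'M[F]_(m + k)) : usubmx (X *m Y) = usubmx X *m Y.
  by rewrite -[in LHS](vsubmxK X) mul_col_mx col_mxKu.
have -> : row_mx 1%:M 0 = usubmx (U *m invmx U) :> 'M[F]_(m, m + k).
  by rewrite mulmxV // scalar_mx_block /block_mx col_mxKu.
rewrite !uK defA; apply/eqP/eqP => [-> //|].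
by move=> /(congr1 (mulmx^~ U)); rewrite !mulmxKV.
Qed.

(** * Monic polynomials indexed by their lower coefficients, and companion matrices *)

Definition monic_of (F : fieldType) (m : nat) (a : 'rV[F]_m) : {poly F} :=
  'X^m + rVpoly a.

Lemma size_monic_of (F : fieldType) (m : nat) (a : 'rV[F]_m) :
  size (monic_of a) = m.+1.
Proof. by rewrite /monic_of size_polyDl size_polyXn // ltnS size_poly. Qed.

Lemma monic_of_monic (F : fieldType) (m : nat) (a : 'rV[F]_m) :
  monic_of a \is monic.
Proof.
rewrite monicE /monic_of lead_coefDl ?lead_coefXn //.
by rewrite size_polyXn ltnS size_poly.
Qed.

Lemma monic_of_poly_rV (F : fieldType) (m : nat) (e : {poly F}) :
  e \is monic -> size e = m.+1 -> monic_of (poly_rV (e - 'X^m) : 'rV_m) = e.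
Proof.
move=> /monicP e_monic sz_e.
rewrite /monic_of poly_rV_K; first by rewrite addrC subrK.
apply/leq_sizeP => j le_mj; rewrite coefB coefXn.
case: eqVneq => [-> | ne_jm]; last first.
  by rewrite subr0 nth_default // sz_e ltn_neqAle eq_sym ne_jm.
by move: e_monic; rewrite lead_coefE sz_e /= => ->; rewrite subrr.
Qed.

Lemma monic_of_inj (F : fieldType) (m : nat) : injective (@monic_of F m).
Proof. by move=> a b /addrI /(can_inj rVpolyK). Qed.

(** The companion matrix of [monic_of a], with dimension the variable [m] itself instead of an
    expression in the size of a polynomial. *)
Definition companion_of (F : fieldType) (m : nat) (a : 'rV[F]_m) : 'M[F]_m :=
  \matrix_(i, j) if i == m.-1 :> nat then - a 0 j else (i.+1 == j :> nat)%:R.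

Lemma char_poly_companion_of (F : fieldType) (m : nat) (a : 'rV[F]_m) :
  char_poly (companion_of a) = monic_of a.
Proof.
(* The dimension is made a variable so that eliminating its equation with [(size p).-1] leaves
   [companionmxK]. *)
have gen (p : {poly F}) d : p \is monic -> (size p).-1 = d ->
    char_poly (\matrix_(i < d, j < d)
      if i == d.-1 :> nat then - p`_j else (i.+1 == j :> nat)%:R) = p.
  by move=> p_monic; case: d /; apply: companionmxK.
rewrite -[RHS](gen (monic_of a) m) ?monic_of_monic ?size_monic_of //.
congr char_poly; apply/matrixP => i j; rewrite !mxE.
by rewrite coefD coefXn coef_rVpoly_ord (ltn_eqF (ltn_ord j)) add0r.
Qed.

Lemma row_companion_of (F : fieldType) (m : nat) (a : 'rV[F]_m) (i j : 'I_m) :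
  i.+1 = j :> nat -> row i (companion_of a) = row j 1%:M.
Proof.
move=> ij; apply/rowP => l; rewrite !mxE ltn_eqF; last first.
  by rewrite -ltnS prednK ?(leq_ltn_trans (leq0n i) (ltn_ord i)) // ij ltn_ord.
by rewrite ij.
Qed.

(** * Pairs in block triangular form *)

Lemma submx_row_mx10 (F : fieldType) (m k : nat) (u : 'rV[F]_(m + k)) :
  (u <= (row_mx 1%:M 0 : 'M_(m, m + k)))%MS = (rsubmx u == 0).
Proof.
apply/submxP/eqP => [[D ->]|u0].
  by rewrite mul_mx_row mulmx0 row_mxKr.
exists (lsubmx u); rewrite mul_mx_row mulmx0 mulmx1.
by rewrite -[LHS]hsubmxK u0.
Qed.

(** The second component is the first basis vector, or 0 when m = 0. *)
Definition cyclic_pair (F : fieldType) (m k : nat)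
    (t : 'M[F]_k * 'rV[F]_m * 'M[F]_(k, m)) : 'M[F]_(m + k) * 'rV[F]_(m + k) :=
  (block_mx (companion_of t.1.2) 0 t.2 t.1.1,
   row_mx (\row_j (j == 0 :> nat)%:R) 0).

Lemma cyclic_pair_inj (F : fieldType) (m k : nat) : injective (@cyclic_pair F m k).
Proof.
move=> [[D a] B] [[D' a'] B'] [] /eq_block_mx[/matrixP eqC _ /= -> ->].
congr (_, _, _); apply/rowP => j.
have lt_m : (m.-1 < m)%N by rewrite prednK ?(leq_ltn_trans (leq0n j) (ltn_ord j)).
by have := eqC (Ordinal lt_m) j; rewrite !mxE eqxx => /oppr_inj.
Qed.

Lemma char_poly_cyclic_pair (F : fieldType) (m k : nat)
    (t : 'M[F]_k * 'rV[F]_m * 'M[F]_(k, m)) :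
  char_poly (cyclic_pair t).1 = monic_of t.1.2 * char_poly t.1.1.
Proof.
rewrite -char_poly_companion_of /char_poly /char_poly_mx map_block_mx /=.
rewrite scalar_mx_block opp_block_mx add_block_mx raddf0 oppr0 addr0.
by rewrite det_lblock.
Qed.

Lemma cyclic_pairX (F : fieldType) (m k : nat) (i : nat)
    (t : 'M[F]_k * 'rV[F]_m * 'M[F]_(k, m)) :
  (cyclic_pair t).2 *m (cyclic_pair t).1 ^+ i =
  row_mx ((\row_j (j == 0 :> nat)%:R) *m companion_of t.1.2 ^+ i) 0.
Proof.
elim: i => [|i IHi]; first by rewrite !expr0 !mulmx1.
rewrite !exprSr !mulmxA IHi /cyclic_pair /= mul_row_block.
by rewrite !mul0mx !addr0 mulmx0.
Qed.

(** The companion block sends each basis vector to the next, so the iterates of the first one run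
    through the first [m] basis vectors. *)
Lemma krylov_cyclic_pair (F : fieldType) (m k : nat)
    (t : 'M[F]_k * 'rV[F]_m * 'M[F]_(k, m)) :
  krylov m (cyclic_pair t) = row_mx 1%:M 0.
Proof.
apply/row_matrixP => i; rewrite rowK cyclic_pairX row_row_mx row0; congr row_mx.
case: i => i; elim: i => [|i IHi] lt_im.
  by rewrite mulmx1; apply/rowP => j; rewrite !mxE eq_sym.
have lt_im' := ltnW lt_im; rewrite exprSr mulmxA (IHi lt_im').
by rewrite -row_mul mul1mx; apply: row_companion_of.
Qed.

(** Since row i of [N] is the image of the i-th iterate, the top rows of [N] are the iterates of
    index 1 to [m]: basis vectors, except for the last, which supplies [a]. *)
Lemma krylov_row_mx10 (F : fieldType) (m k : nat)
    (x : 'M[F]_(m + k) * 'rV[F]_(m + k)) :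
  krylov m x = row_mx 1%:M 0 -> rsubmx (x.2 *m x.1 ^+ m) = 0 ->
  exists t : 'M[F]_k * 'rV[F]_m * 'M[F]_(k, m), x = cyclic_pair t.
Proof.
case: x => N w /= defK wNm.
have wX (i : 'I_m) : w *m N ^+ i = row_mx (row i 1%:M) 0.
  by have := congr1 (row i) defK; rewrite rowK row_row_mx row0.
have uN : usubmx N = krylov m (N, w) *m N.
  by rewrite defK -[in RHS](vsubmxK N) mul_row_col mul1mx mul0mx addr0.
(* The sign matches the last row of [companion_of a], which is [- a]. *)
pose a := - lsubmx (w *m N ^+ m).
have uNE : usubmx N = row_mx (companion_of a) 0.
  apply/row_matrixP => i; rewrite uN row_mul rowK -mulmxA.
  have -> : N ^+ i *m N = N ^+ i.+1 by rewrite exprSr.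
  rewrite row_row_mx row0.
  have [lt_im|ge_im] := ltnP i.+1 m.
    by rewrite (wX (Ordinal lt_im)) (@row_companion_of _ _ _ _ (Ordinal lt_im)).
  have Dm : i.+1 = m by apply/eqP; rewrite eqn_leq ge_im ltn_ord.
  rewrite Dm -[LHS]hsubmxK wNm; congr row_mx; apply/rowP => j.
  have im : i == m.-1 :> nat by rewrite -(congr1 predn Dm).
  by rewrite [RHS]mxE [RHS]mxE im !mxE opprK.
exists (drsubmx N, a, dlsubmx N); rewrite /cyclic_pair /=; congr (_, _).
  by rewrite -[LHS]vsubmxK uNE -[dsubmx N]hsubmxK.
(* For m = 0 no iterate pins down [w]; the hypothesis on [w *m N ^+ m], now [w] itself, makes it
   zero. *)
have [m0|m_gt0] := posnP m.
  rewrite -[LHS]hsubmxK; congr row_mx.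
    by apply/rowP => j; have := ltn_ord j; rewrite [X in (_ < X)%N]m0.
  by move: wNm; rewrite [X in _ ^+ X]m0 mulmx1.
have := wX (Ordinal m_gt0); rewrite /= mulmx1 => ->; congr row_mx.
by apply/rowP => j; rewrite !mxE eq_sym.
Qed.

(** The lower left block does not affect the characteristic polynomial, hence the factor
    [#|F| ^ (k * m)]. *)
Lemma card_krylov_row_mx10 (F : finFieldType) (m k : nat) (Q : pred {poly F}) :
  #|[set x : 'M[F]_(m + k) * 'rV[F]_(m + k) |
      [&& Q (char_poly x.1), krylov m x == row_mx 1%:M 0
        & (x.2 *m x.1 ^+ m <= (row_mx 1%:M 0 : 'M_(m, m + k)))%MS]]| =
  ((\sum_(D : 'M[F]_k) #|[set a : 'rV[F]_m | Q (monic_of a * char_poly D)%R]|) *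
    #|F| ^ (k * m))%N.
Proof.
pose S := [set Da : 'M[F]_k * 'rV[F]_m | Q (monic_of Da.2 * char_poly Da.1)].
have -> : (\sum_(D : 'M[F]_k)
    #|[set a : 'rV[F]_m | Q (monic_of a * char_poly D)%R]|)%N = #|S|.
  under eq_bigr => D _ do rewrite -sum1dep_card.
  by rewrite pair_big_dep /= sum1dep_card.
rewrite -card_mx -cardsT -cardsX -(card_imset _ (@cyclic_pair_inj F m k)).
apply: eq_card => x; rewrite inE submx_row_mx10.
apply/and3P/imsetP => [[Qx /eqP Kx /eqP rx]|[[Da B]]].
  have [t def_x] := krylov_row_mx10 Kx rx.
  by exists t => //; move: Qx; rewrite def_x char_poly_cyclic_pair !inE => ->.
rewrite !inE andbT => QDa ->.
by rewrite char_poly_cyclic_pair krylov_cyclic_pair cyclic_pairX row_mxKr.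
Qed.

(** * Counting pairs by the dimension of their cyclic subspace *)

Lemma krylov_conj (F : fieldType) (n i : nat) (P M : 'M[F]_n) (v : 'rV[F]_n) :
  P \in unitmx ->
  (v *m invmx P) *m (P *m M *m invmx P) ^+ i = v *m M ^+ i *m invmx P.
Proof.
move=> uP; elim: i => [|i IHi]; first by rewrite !expr0 !mulmx1.
by rewrite !exprSr !mulmxA IHi mulmxKV.
Qed.

(** Once the next iterate depends on the first [m], their span is stable and is the whole cyclic
    subspace. *)
Definition cyclic_dim (F : fieldType) (n m : nat) (x : 'M[F]_n * 'rV[F]_n) : bool :=
  row_free (krylov m x) && (x.2 *m x.1 ^+ m <= krylov m x)%MS.

(** Couples (x, P) with P invertible and top rows [krylov m x] are counted twice: by completing the
    rows for fixed x, and by passing to the basis P, where x takes block triangular form, for fixed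
    P. The common factor [#|F| ^ (k * m)] cancels. *)
Lemma card_cyclic_dim (F : finFieldType) (m k : nat) (Q : pred {poly F}) :
  (#|[set x : 'M[F]_(m + k) * 'rV[F]_(m + k) |
       Q (char_poly x.1) && cyclic_dim m x]| * unit_count F k =
   unit_count F (m + k) *
   \sum_(D : 'M[F]_k) #|[set a : 'rV[F]_m | Q (monic_of a * char_poly D)%R]|)%N.
Proof.
have q_gt0 : (0 < #|F| ^ (k * m))%N.
  by rewrite expn_gt0; apply/orP; left; apply/card_gt0P; exists 0.
pose X := [pred x : 'M[F]_(m + k) * 'rV[F]_(m + k) |
  Q (char_poly x.1) && cyclic_dim m x].
pose R (x : 'M[F]_(m + k) * 'rV[F]_(m + k)) (P : 'M[F]_(m + k)) :=
  usubmx P == krylov m x.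
have := double_count X [pred P | P \in unitmx] R.
have -> : (\sum_(x | X x) #|[set P | [pred P | P \in unitmx] P && R x P]| =
    \sum_(x | X x) (#|F| ^ (k * m) * unit_count F k))%N.
  apply: eq_bigr => x /andP[_ /andP[freeK _]].
  exact: (card_unit_usubmx freeK).
rewrite sum_nat_const.
have -> : (\sum_(P : 'M[F]_(m + k) | P \in unitmx) #|[set x | X x & R x P]| =
    \sum_(P : 'M[F]_(m + k) | P \in unitmx)
      ((\sum_(D : 'M[F]_k) #|[set a : 'rV[F]_m | Q (monic_of a * char_poly D)%R]|)
       * #|F| ^ (k * m)))%N.
  apply: eq_bigr => P uP; rewrite -card_krylov_row_mx10.
  (* Change of basis carrying the rows of [P] to the standard basis vectors. *)
  pose phi (x : 'M[F]_(m + k) * 'rV[F]_(m + k)) :=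
    (P *m x.1 *m invmx P, x.2 *m invmx P).
  have phi_inj : injective phi.
    move=> [M v] [M' v'] [] /= /(congr1 (fun A => invmx P *m A *m P)).
    rewrite -!mulmxA !mulVmx // !mulmx1 !mulKmx // => ->.
    by move=> /(congr1 (mulmx^~ P)); rewrite !mulmxKV // => ->.
  rewrite -[RHS](card_preimset _ phi_inj); apply: eq_card => x.
  have Kphi : krylov m (phi x) = krylov m x *m invmx P.
    by apply/row_matrixP => i; rewrite row_mul !rowK krylov_conj.
  have uPK : usubmx P *m invmx P = row_mx 1%:M 0.
    rewrite -[RHS](mulmxK uP) -{3}[P]vsubmxK mul_row_col mul1mx mul0mx.
    by rewrite addr0.
  have Kid : (usubmx P == krylov m x) = (krylov m (phi x) == row_mx 1%:M 0).
    rewrite Kphi -uPK; apply/eqP/eqP => [-> //|].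
    by move=> /(congr1 (mulmx^~ P)); rewrite !mulmxKV.
  rewrite !inE /R Kid char_poly_conj_unit // -andbA; congr (_ && _).
  rewrite andbC; case: eqP => //= Kx.
  have defK : krylov m x = usubmx P by apply/esym/eqP; rewrite Kid Kx.
  have freeP : row_free (invmx P) by rewrite row_free_unit unitmx_inv.
  rewrite krylov_conj // -Kx Kphi submxMfree // /cyclic_dim andb_idl // => _.
  rewrite /row_free -(mxrankMfree (krylov m x) freeP) -Kphi Kx.
  by rewrite -pid_mx_row rank_pid_mx ?leq_addr.
rewrite sum_nat_const [(_ ^ _ * unit_count _ _)%N]mulnC !mulnA => eqXP.
have -> : unit_count F (m + k) = #|[pred P : 'M[F]_(m + k) | P \in unitmx]|.
  by rewrite /unit_count cardsE.
apply/eqP; rewrite -(eqn_pmul2r q_gt0); apply/eqP.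
by rewrite -eqXP cardsE.
Qed.

(** Telescoping: with [p m] counting pairs whose first [m] iterates are independent, [p m - p m.+1]
    counts cyclic dimension [m], [p 0] counts all pairs, and [p n.+1] vanishes. *)
Lemma sum_cyclic_dim (F : finFieldType) (n : nat) (Q : pred 'M[F]_n) :
  (#|[set M | Q M]| * #|F| ^ n =
   \sum_(m < n.+1) #|[set x : 'M[F]_n * 'rV[F]_n | Q x.1 && cyclic_dim m x]|)%N.
Proof.
pose p m := #|[set x : 'M[F]_n * 'rV[F]_n | Q x.1 && row_free (krylov m x)]|.
have pS m : p m =
  (#|[set x : 'M[F]_n * 'rV[F]_n | Q x.1 && cyclic_dim m x]| + p m.+1)%N.
  pose S := [set x : 'M[F]_n * 'rV[F]_n | (x.2 *m x.1 ^+ m <= krylov m x)%MS].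
  rewrite -[LHS](cardsID S).
  congr (_ + _)%N; apply: eq_card => x; rewrite !inE.
    by rewrite andbA.
  by rewrite row_free_krylovS andbC andbA.
have p0 j : p 0%N = (\sum_(m < j)
    #|[set x : 'M[F]_n * 'rV[F]_n | Q x.1 && cyclic_dim m x]| + p j)%N.
  elim: j => [|j IHj]; first by rewrite big_ord0.
  by rewrite big_ord_recr /= IHj [p j]pS addnA.
have pn : p n.+1 = 0%N.
  apply/eqP; rewrite cards_eq0; apply/eqP/setP => x; rewrite !inE.
  rewrite /row_free ltn_eqF ?andbF // ltnS; exact: rank_leq_col.
transitivity (p 0%N); last by rewrite (p0 n.+1) pn addn0.
have -> : (#|F| ^ n)%N = #|[set: 'rV[F]_n]| by rewrite cardsT card_mx mul1n.
rewrite -cardsX; apply: eq_card => x; rewrite !inE andbT.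
by rewrite /row_free [krylov 0 x]flatmx0 mxrank0 andbT.
Qed.

(** * Monic multiples of a polynomial in a short interval, with prescribed constant term *)

Definition in_I0 (F : fieldType) (f : {poly F}) (h : nat) (c : F)
    (g : {poly F}) : bool :=
  in_I f h g && (g`_0 == c).

(** The quotient [e] of [f] by [g] is a base point. Admissible cofactors are [e + w] with w of
    degree at most h - k; the constant term of w is forced by [c], and its other h - k coefficients
    are free. *)
Lemma card_in_I0_multiples (F : finFieldType) (m k h : nat) (f g : {poly F})
    (c : F) :
  f \is monic -> size f = (m + k).+1 -> g \is monic -> size g = k.+1 ->
  g`_0 != 0 -> (k <= h)%N -> (h < m + k)%N ->
  #|[set a : 'rV[F]_m | in_I0 f h c (monic_of a * g)]| = (#|F| ^ (h - k))%N.
Proof.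
move=> f_monic sz_f g_monic sz_g g0 le_kh lt_h.
have g_neq0 : g != 0 by apply: monic_neq0.
have [e [r [e_monic sz_e sz_r Df]]] : exists e r : {poly F},
    [/\ e \is monic, size e = m.+1, (size r <= k)%N & f = e * g + r].
  have sz_r : (size (f %% g)%R <= k)%N by rewrite -ltnS -sz_g ltn_modp.
  exists (f %/ g), (f %% g); split=> //; last exact: divp_eq.
    apply/monicP; rewrite -(lead_coef_Mmonic _ g_monic).
    have -> : f %/ g * g = f - f %% g by rewrite {2}(divp_eq f g) addrK.
    rewrite lead_coefDl ?(monicP f_monic) // size_polyN sz_f.
    by rewrite (leq_ltn_trans sz_r) // ltnS leq_addl.
  by rewrite size_divp // sz_f sz_g /= subSn ?leq_addl // addnK.
(* The only constant term of w for which [(e + w) * g] has constant term [c]. *)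
pose d : F := c / g`_0 - e`_0.
pose w (b : 'rV[F]_(h - k)) : {poly F} := d%:P + 'X * rVpoly b.
have sz_w b : (size (w b) <= (h - k).+1)%N.
  apply: leq_trans (size_polyD _ _) _; rewrite geq_max.
  rewrite (leq_trans (size_polyC_leq1 _)) //=.
  rewrite (leq_trans (size_polyMleq _ _)) // size_polyX /=.
  by rewrite ltnS size_poly.
have sz_wm b : (size (w b) < m.+1)%N.
  by rewrite ltnS (leq_trans (sz_w b)) //; lia.
have E_monic b : e + w b \is monic.
  by rewrite monicE lead_coefDl ?sz_e // (monicP e_monic).
have sz_E b : size (e + w b) = m.+1 by rewrite size_polyDl sz_e.
have E0 b : ((e + w b) * g)`_0 = c.
  rewrite coef0M !coefD coefC coefXM /= addr0 /d.
  by rewrite addrC subrK divfK.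
have fE b : (size (f - (e + w b) * g)%R <= h.+1)%N.
  rewrite Df mulrDl opprD addrACA subrr add0r.
  apply: leq_trans (size_polyD _ _) _; rewrite geq_max size_polyN.
  rewrite (leq_trans sz_r) ?(leq_trans le_kh) //=.
  rewrite (leq_trans (size_polyMleq _ _)) // sz_g addnS /=.
  by rewrite (leq_trans (leq_add (sz_w b) (leqnn k))) // addSn subnK.
pose psi b : 'rV[F]_m := poly_rV (e + w b - 'X^m).
have psiK b : monic_of (psi b) = e + w b by apply: monic_of_poly_rV.
have psi_inj : injective psi.
  move=> b b' /(congr1 (@monic_of F m)); rewrite !psiK => /addrI /addrI.
  by move=> /(mulfI (negbT (polyX_eq0 F))) /(can_inj rVpolyK).
rewrite -[(h - k)%N]mul1n -card_mx -cardsT -(card_imset _ psi_inj).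
apply: eq_card => a; rewrite inE; apply/idP/imsetP => [|[b _ ->]]; last first.
  by rewrite psiK /in_I0 /in_I E0 fE eqxx monicMl ?g_monic ?E_monic.
move=> /andP[/andP[_ sz_a] /eqP a0].
(* The difference from the solution [e + w 0] has zero constant term and degree at most h - k, so it
   is ['X] times some [rVpoly b]. *)
pose u := monic_of a - (e + w 0).
have u0 : u`_0 = 0.
  by apply: (mulIf g0); rewrite mul0r -coef0M mulrBl coefB a0 E0 subrr.
have sz_u : (size u <= (h - k).+1)%N.
  have [->|u_neq0] := eqVneq u 0; first by rewrite size_poly0.
  have : (size (u * g)%R <= h.+1)%N.
    have -> : u * g = (f - (e + w 0) * g) - (f - monic_of a * g).
      by rewrite /u; ring.
    apply: leq_trans (size_polyD _ _) _; rewrite geq_max size_polyN.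
    by rewrite fE sz_a.
  by rewrite size_Mmonic // sz_g addnS /=; lia.
have [b Du] : exists b : 'rV[F]_(h - k), u = 'X * rVpoly b.
  exists (poly_rV (\poly_(i < h - k) u`_i.+1)).
  rewrite poly_rV_K ?size_poly //; apply/polyP => - [|i]; rewrite coefXM //=.
  rewrite coef_poly; case: ltnP => // le_i.
  by rewrite nth_default // (leq_trans sz_u).
exists b => //; apply: (@monic_of_inj F m); rewrite psiK.
by rewrite -[LHS](subrK (e + w 0)) -/u Du /w linear0 mulr0 addr0 addrC addrA.
Qed.

Lemma card_in_I0_multiples_le1 (F : finFieldType) (m k h : nat) (f g : {poly F})
    (c : F) :
  g \is monic -> size g = k.+1 -> (h < k)%N ->
  (#|[set a : 'rV[F]_m | in_I0 f h c (monic_of a * g)]| <= 1)%N.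
Proof.
move=> g_monic sz_g lt_hk; apply/card_le1_eqP => b a.
rewrite !inE => /andP[/andP[_ sz_b] _] /andP[/andP[_ sz_a] _].
apply: (@monic_of_inj F m); apply/eqP; rewrite -subr_eq0; apply/eqP.
set u := _ - _; have [//|u_neq0] := eqVneq u 0.
have : (size (u * g)%R <= h.+1)%N.
  have -> : u * g = (f - monic_of b * g) - (f - monic_of a * g).
    by rewrite /u; ring.
  apply: leq_trans (size_polyD _ _) _; rewrite geq_max size_polyN.
  by rewrite sz_a sz_b.
rewrite size_Mmonic // sz_g addnS /= => le_uk; exfalso.
move: u_neq0; rewrite -size_poly_gt0 => sz_u.
by have := leq_trans (leq_add sz_u lt_hk) le_uk; rewrite add1n ltnn.
Qed.

Lemma card_in_I0_multiples0 (F : finFieldType) (m h : nat) (f g : {poly F}) (c : F) :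
  g`_0 = 0 -> c != 0 ->
  #|[set a : 'rV[F]_m | in_I0 f h c (monic_of a * g)]| = 0%N.
Proof.
move=> g0 c_neq0; apply/eqP; rewrite cards_eq0; apply/eqP/setP => a.
by rewrite !inE /in_I0 coef0M g0 mulr0 eq_sym (negPf c_neq0) andbF.
Qed.

(** * Comparison of GL with SL, and sums over the diagonal block [D] *)

Lemma unit_count_SL (F : finFieldType) (n : nat) :
  (unit_count F n.+1 = #|F|.-1 * #|SL_set F n.+1|)%N.
Proof.
(* Left multiplication by diag(c, 1, ..., 1) carries SL onto the matrices of determinant [c]; the
   positive dimension provides the first diagonal entry. *)
pose d (c : F) : 'M[F]_n.+1 := diag_mx (\row_j if j == 0 then c else 1).
have det_d c : \det (d c) = c.
  rewrite det_diag big_ord_recl mxE eqxx big1 ?mulr1 // => i _.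
  by rewrite mxE.
rewrite /unit_count -sum1dep_card.
rewrite (partition_big (fun M : 'M[F]_n.+1 => \det M) (predC1 0)) /=; last first.
  by move=> M; rewrite unitmxE unitfE.
rewrite (eq_bigr (fun=> #|SL_set F n.+1|)) => [|c c_neq0].
  by rewrite sum_nat_const cardC1.
have d_inj : injective (mulmx (d c) : 'M[F]_n.+1 -> 'M[F]_n.+1).
  by apply: (can_inj (mulKmx _)); rewrite unitmxE unitfE det_d.
rewrite sum1dep_card -(card_preimset _ d_inj); apply: eq_card => M.
rewrite !inE unitmxE unitfE det_mulmx det_d mulf_eq0 (negPf c_neq0) /=.
rewrite -{2}[c]mulr1 (inj_eq (mulfI c_neq0)).
by have [->|] := eqVneq (\det M) 1; rewrite ?oner_eq0 ?andbF.
Qed.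

Lemma card_cyclic_dim_subn (F : finFieldType) (n k : nat) (Q : pred {poly F}) :
  (k <= n)%N ->
  (#|[set x : 'M[F]_n * 'rV[F]_n | Q (char_poly x.1) && cyclic_dim (n - k) x]|
     * unit_count F k =
   unit_count F n *
   \sum_(D : 'M[F]_k)
     #|[set a : 'rV[F]_(n - k) | Q (monic_of a * char_poly D)%R]|)%N.
Proof.
move=> le_kn; have := card_cyclic_dim (n - k) k Q.
by rewrite subnK.
Qed.

Lemma sum_in_I0_le (F : finFieldType) (m k h : nat) (f : {poly F}) (c : F) :
  c != 0 -> (h < k)%N ->
  (\sum_(D : 'M[F]_k)
     #|[set a : 'rV[F]_m | in_I0 f h c (monic_of a * char_poly D)%R]|
   <= unit_count F k)%N.
Proof.
move=> c_neq0 lt_hk; rewrite /unit_count -sum1dep_card.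
rewrite (bigID (fun D => D \in unitmx)) /= [X in (_ + X)%N]big1 => [|D].
  rewrite addn0; apply: leq_sum => D _.
  by apply: (@card_in_I0_multiples_le1 F m k);
    rewrite ?char_poly_monic ?size_char_poly.
rewrite unitmxE unitfE negbK => /eqP det0.
by rewrite card_in_I0_multiples0 // char_poly_det det0 mulr0.
Qed.

Lemma sum_in_I0_eq (F : finFieldType) (m k h : nat) (f : {poly F}) (c : F) :
  f \is monic -> size f = (m + k).+1 -> c != 0 -> (k <= h)%N -> (h < m + k)%N ->
  (\sum_(D : 'M[F]_k)
     #|[set a : 'rV[F]_m | in_I0 f h c (monic_of a * char_poly D)%R]|
   = unit_count F k * #|F| ^ (h - k))%N.
Proof.
move=> f_monic sz_f c_neq0 le_kh lt_h; rewrite /unit_count -sum_nat_cond_const.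
rewrite (bigID (fun D => D \in unitmx)) /= [X in (_ + X)%N]big1 => [|D].
  rewrite addn0; apply: eq_bigr => D.
  rewrite unitmxE unitfE => det_neq0.
  rewrite (@card_in_I0_multiples F m k) ?char_poly_monic ?size_char_poly //.
  by rewrite char_poly_det mulf_neq0 // signr_eq0.
rewrite unitmxE unitfE negbK => /eqP det0.
by rewrite card_in_I0_multiples0 // char_poly_det det0 mulr0.
Qed.

(** * The bound on the probability *)

Theorem theorem4p8 (F : finFieldType) (n h : nat) (f : {poly F}) :
  (0 < n)%N -> (h < n)%N -> f \is monic -> size f = n.+1 ->
  let q : rat := (#|F|)%:R in
  `| prob_SL (fun M : 'M[F]_n => in_I f h (char_poly M)) - q ^+ h.+1 / q ^+ n |
    <= (q - 1) * (n - h)%:R / q ^+ n.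
Proof.
move=> n_gt0 lt_hn f_monic sz_f; lazy zeta; set q : rat := #|F|%:R.
have q_ge2 : 2 <= q by rewrite /q ler_nat card_finNzRing_gt1.
have qn_gt0 : 0 < q ^+ n by rewrite exprn_gt0 //; lra.
have g_gt0 k : 0 < (unit_count F k)%:R :> rat.
  by rewrite ltr0n; apply/card_gt0P; exists 1%:M; rewrite inE unitmx1.
(* The constant coefficient of [char_poly M] is (-1)^n det M, so it equals [c] exactly when det M =
   1. *)
pose c : F := (-1) ^+ n.
have c_neq0 : c != 0 by rewrite signr_eq0.
pose Q := in_I0 f h c.
pose N := #|[set M : 'M[F]_n | Q (char_poly M)]|.
have defN : #|[set M in SL_set F n | in_I f h (char_poly M)]| = N.
  apply: eq_card => M; rewrite !inE /Q /in_I0 char_poly_det andbC.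
  by rewrite -[c]mulr1 (inj_eq (mulfI c_neq0)).
pose X k := #|[set x : 'M[F]_n * 'rV[F]_n |
  Q (char_poly x.1) && cyclic_dim (n - k) x]|.
(* Contribution of the pairs of cyclic codimension [k], normalised by |GL_n|. *)
pose s k : rat := (X k)%:R / (unit_count F n)%:R.
have sE k : (k <= h)%N -> s k = q ^+ (h - k).
  move=> le_kh; have le_kn : (k <= n)%N by lia.
  have := card_cyclic_dim_subn Q le_kn.
  rewrite sum_in_I0_eq ?subnK // -/(X k) => /(congr1 (fun i => i%:R : rat)).
  rewrite !natrM natrX -/q => eqX; apply/eqP.
  rewrite /s eq_sym -(inj_eq (mulIf (lt0r_neq0 (g_gt0 n)))) divfK ?lt0r_neq0 //.
  apply/eqP/(mulIf (lt0r_neq0 (g_gt0 k))); rewrite eqX; ring.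
have s_ge0 k : 0 <= s k by rewrite divr_ge0 ?ler0n.
have s_le1 k : (h < k <= n)%N -> s k <= 1.
  move=> /andP[lt_hk le_kn]; have := card_cyclic_dim_subn Q le_kn.
  rewrite -/(X k) => eqX.
  rewrite /s ler_pdivrMr ?mul1r // ler_nat.
  rewrite -(leq_pmul2r (_ : 0 < unit_count F k)%N) ?eqX ?leq_mul2l.
    by rewrite sum_in_I0_le ?orbT.
  by rewrite -(ltr0n rat).
pose t := \sum_(h.+1 <= k < n.+1) s k.
have t_ge0 : 0 <= t by apply: sumr_ge0.
have t_le : t <= (n - h)%:R.
  rewrite -(subSS h n) -[leRHS]mulr1 mulr_natl -sumr_const_nat.
  by apply: ler_sum_nat => k /andP[lt_hk lt_kn]; rewrite s_le1 ?lt_hk.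
have sumN : N%:R * q ^+ n / (unit_count F n)%:R =
    \sum_(0 <= k < h.+1) q ^+ (h - k) + t.
  have := sum_cyclic_dim (fun M : 'M[F]_n => Q (char_poly M)).
  (* The reversal passes from the cyclic dimension to the codimension [k]. *)
  rewrite -/N (reindex_inj rev_ord_inj) /=.
  move=> /(congr1 (fun i => i%:R : rat)); rewrite natrM natrX -/q => ->.
  rewrite natr_sum mulr_suml.
  transitivity (\sum_(0 <= k < n.+1) s k).
    by rewrite big_mkord; apply: eq_bigr => i _; rewrite /s /X subSS.
  rewrite (big_cat_nat (n := h.+1)) ?ltnS ?(ltnW lt_hn) //=; congr (_ + _).
  by apply: eq_big_nat => k /andP[_ lt_kh]; rewrite sE.
have geom : (q - 1) * \sum_(0 <= k < h.+1) q ^+ (h - k) = q ^+ h.+1 - 1.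
  rewrite subrX1 big_mkord (reindex_inj rev_ord_inj) /=; congr (_ * _).
  by apply: eq_bigr => i _; rewrite subSS subKn // -ltnS.
have cardGL : (unit_count F n)%:R = (q - 1) * (#|SL_set F n|)%:R.
  rewrite -(prednK n_gt0) unit_count_SL natrM -subn1 natrB //.
  by rewrite (ltnW (card_finNzRing_gt1 F)).
have := g_gt0 n; rewrite cardGL => cardGL_gt0.
have q1_gt0 : 0 < q - 1 by lra.
have SL_gt0 : 0 < (#|SL_set F n|)%:R :> rat by rewrite -(pmulr_rgt0 _ q1_gt0).
rewrite /prob_SL defN.
have -> : N%:R / (#|SL_set F n|)%:R = (q ^+ h.+1 - 1 + (q - 1) * t) / q ^+ n.
  rewrite -geom -mulrDr -sumN cardGL; field.
  by rewrite !lt0r_neq0.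
rewrite -mulrBl normrM [X in _ * X]gtr0_norm ?invr_gt0 // ler_pM2r ?invr_gt0 //.
(* What remains is to bound |(q - 1) t - 1| by (q - 1)(n - h). The upper side uses [t_le]; the lower
   side uses [t_ge0] and 1 <= (q - 1)(n - h), which holds as q >= 2 and n - h >= 1. *)
have nh_ge1 : 1 <= (n - h)%:R :> rat by rewrite ler1n subn_gt0.
rewrite ler_norml; apply/andP; split; nra.
Qed.
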